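(* Let $X$ be a compact $\mathbb{R}$-tree. Then its magnitude is $|X|=1+\frac{\lambda(X)}{2}$, where $\lambda(X)\in[0,\infty]$ is its total length. In particular, $|X|=\infty$ when $\lambda(X)=\infty$.
   Context: An $\mathbb{R}$-tree is a uniquely geodesic metric space (any two points $x,y$ are joined by a unique segment $\llbracket x,y\rrbracket$, i.e. subset isometric to $[0,d(x,y)]$ with endpoints $x,y$) such that $\llbracket x,z\rrbracket\subseteq\llbracket x,y\rrbracket\cup\llbracket y,z\rrbracket$ for all $x,y,z$. Its skeleton is $\operatorname{Sk}(X)=\bigcup_{x,y\in X}\llbracket x,y\rrbracket\setminus\{x,y\}$, and the total length is $\lambda(X)=\mathscr{H}^1(\operatorname{Sk}(X))$ ($\mathscr{H}^1$ = one-dimensional Hausdorff measure). Compact $\mathbb{R}$-trees are of negative type ($(X,\sqrt d)$ embeds isometrically in a Hilbert space), so $\langle\mu,\nu\rangle_{\mathscr W}=\int\int e^{-d(x,y)}\mu(dx)\nu(dy)$ is an inner product on finite signed Borel measures, with norm $\|\cdot\|_{\mathscr W}$. The magnitude is $|X|=\sup\{1/\|\mu\|_{\mathscr W}^2:\mu \text{ finite signed Borel measure on }X,\ \mu(X)=1\}\in(0,\infty]$. *)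

(* Defs.v *)
From HB Require Import structures.
From mathcomp Require Import all_boot all_order all_algebra.
From mathcomp Require Import all_classical all_reals all_analysis.
Set Implicit Arguments. Unset Strict Implicit. Unset Printing Implicit Defensive.
Import Order.TTheory GRing.Theory Num.Theory.
Import numFieldNormedType.Exports.
Local Open Scope classical_set_scope.
Local Open Scope ring_scope.

Section Defs.
Context {R : realType} {T : metricType R}.
Local Notation d := (@mdist R T).

Definition is_segment (x y : T) (S : set T) : Prop :=
  exists g : R -> T,
    [/\ forall s t, 0 <= s <= d x y -> 0 <= t <= d x y -> d (g s) (g t) = `|s - t|,
        g 0 = x, g (d x y) = y & S = g @` `[0, d x y]].

Definition is_Rtree : Prop :=
  (forall x y : T, exists! S, is_segment x y S) /\
  (forall (x y z : T) (Sxy Syz Sxz : set T),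
     is_segment x y Sxy -> is_segment y z Syz -> is_segment x z Sxz ->
     Sxz `<=` Sxy `|` Syz).

Definition skeleton : set T :=
  [set p | exists (x y : T) (S : set T),
     [/\ is_segment x y S, S p, p <> x & p <> y]].

Local Open Scope ereal_scope.

(** diameter (diam of the empty set is 0) *)
Definition diam (A : set T) : \bar R :=
  ereal_sup ([set (d x y)%:E | x in A & y in A] `|` [set 0]).

Definition hausdorff1_delta (delta : R) (A : set T) : \bar R :=
  ereal_inf [set s | exists U : nat -> set T,
    [/\ A `<=` \bigcup_i U i, (forall i, diam (U i) <= delta%:E)
      & s = \sum_(0 <= i <oo) diam (U i)]].

Definition hausdorff1 (A : set T) : \bar R :=
  ereal_sup [set hausdorff1_delta delta A | delta in [set delta : R | (0 < delta)%R]].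

Definition total_length : \bar R := hausdorff1 skeleton.

End Defs.

(** Borel sigma-algebra of a (nonempty) metric space.  The library's
    generated-sigma-algebra type needs a pointedType; [pointed_at T x0] is
    T itself, pointed at x0. *)
Definition pointed_at (T : Type) (x0 : T) : Type := T.
HB.instance Definition _ (T : choiceType) (x0 : T) := Choice.on (@pointed_at T x0).
HB.instance Definition _ (T : choiceType) (x0 : T) :=
  isPointed.Build (@pointed_at T x0) x0.

Notation borel T x0 := (g_sigma_algebraType (@open T : set (set (@pointed_at T x0)))).

Section SignedIntegral.
Context {R : realType} {T : metricType R} (x0 : T).
Local Open Scope ereal_scope.
Local Notation X := (borel T x0).

Definition hahnP (nu : {charge set X -> \bar R}) : set X :=
  projT1 (cid (Hahn_decomposition nu)).
Definition hahnN (nu : {charge set X -> \bar R}) : set X :=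
  projT1 (cid (projT2 (cid (Hahn_decomposition nu)))).
Lemma hahnPN (nu : {charge set X -> \bar R}) :
  hahn_decomposition nu (hahnP nu) (hahnN nu).
Proof. exact: (projT2 (cid (projT2 (cid (Hahn_decomposition nu))))). Qed.

Definition cintegral (nu : {charge set X -> \bar R}) (f : X -> \bar R) : \bar R :=
  \int[jordan_pos (hahnPN nu)]_x f x - \int[jordan_neg (hahnPN nu)]_x f x.

Definition W_inner (mu nu : {charge set X -> \bar R}) : \bar R :=
  cintegral nu (fun y => cintegral mu (fun x => (expR (- @mdist R T x y))%:E)).

Definition magnitude : \bar R :=
  ereal_sup [set ((fine (W_inner mu mu))^-1)%:E |
               mu in [set mu : {charge set X -> \bar R} | mu [set: X] = 1]].

End SignedIntegral.

(* Main.v *)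
(** Root the tree at [r], with height [h x = d(r, x)], and order it by ancestry; the
    meet of two points satisfies [d(x, y) = h x + h y - 2 h (meet x y)], so
    [exp (- d(x, y)) = exp (- h x) exp (- h y) exp (2 h (meet x y))].  On a finite
    meet-closed set containing [r], telescoping [exp (2 h)] along the parent function
    diagonalises this kernel.  Cauchy-Schwarz in that diagonal form, and its equality
    case, show that such a set has magnitude [1 + sum of tanh (l / 2)], [l] ranging
    over the lengths of its edges, which is at most [1 + L / 2] for [L] the sum of
    the lengths and tends to it when the edges are subdivided.

    A signed measure is approximated by finitely supported ones along partitions into
    small cells, so the magnitude of the whole tree is the supremum over the finite
    meet-closed sets.  The supremum of [L] is the total length: shrunken edges are
    separated, so a fine cover of the skeleton covers each of them by different sets;
    conversely, attaching the points of a dense sequence one after the other covers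
    the skeleton by countably many segments whose first [n] have total length at most
    the [L] of a suitable finite set. *)
Require Import Defs.
From HB Require Import structures.
From mathcomp Require Import all_boot all_order all_algebra.
From mathcomp Require Import all_classical all_reals all_analysis.
From mathcomp Require Import ring lra.
Import Order.TTheory GRing.Theory Num.Theory.
Import numFieldNormedType.Exports.
Local Open Scope classical_set_scope.
Local Open Scope ring_scope.
Set Implicit Arguments. Unset Strict Implicit. Unset Printing Implicit Defensive.

(** * Rooted trees *)

Section Betweenness.
Context {R : realType} {T : metricType R}.
Local Notation d := (@mdist R T).

Definition between (x p y : T) := d x p + d p y = d x y.

Lemma mdist0_eq (x y : T) : d x y <= 0 -> x = y.
Proof.
by move=> h; apply: mdist_positivity; apply/eqP; rewrite eq_le h mdist_ge0.
Qed.

Lemma mdist_lip x y z : `|d x y - d x z| <= d y z.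
Proof.
have := metric_triangle x y z; have := metric_triangle x z y.
by rewrite (metric_sym z y) ler_norml => *; apply/andP; split; lra.
Qed.

Lemma between_sym x p y : between x p y -> between y p x.
Proof. by rewrite /between (metric_sym y) (metric_sym p x) (metric_sym y x) addrC. Qed.

Lemma segment_between x y (S : set T) p : is_segment x y S -> S p -> between x p y.
Proof.
case=> g [gi g0 gl ->] [t /=]; rewrite in_itv /= => tl <-.
have h0 : 0 <= (0 : R) <= d x y by rewrite lexx mdist_ge0.
have hl : 0 <= d x y <= d x y by rewrite lexx mdist_ge0.
rewrite /between -{1}g0 -{1}gl !gi //; case/andP: tl => t0 tl.
rewrite sub0r normrN (ger0_norm t0) ler0_norm; lra.
Qed.

Context (HT : @is_Rtree R T).

Lemma segment_exists x y : exists S : set T, is_segment x y S.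
Proof. by case: HT => /(_ x y) [S [hS _]] _; exists S. Qed.

Lemma tree_point x y (t : R) : 0 <= t <= d x y ->
  exists p, between x p y /\ d x p = t.
Proof.
move=> tl; have [S hS] := segment_exists x y.
have [g [gi g0 gl eS]] := hS; exists (g t); split.
  by apply: segment_between hS _; rewrite eS; exists t => //=; rewrite in_itv.
have h0 : 0 <= (0 : R) <= d x y by rewrite lexx mdist_ge0.
by rewrite -{1}g0 (gi _ _ h0 tl) sub0r normrN ger0_norm //; case/andP: tl.
Qed.

(** The point [u] of [S] at distance [d x p] from [x] lies on a segment from [x] to [p] or from [p]
    to [y], by the tree condition. Either way the distances force [u = p]. *)
Lemma between_segment x p y (S : set T) : is_segment x y S -> between x p y -> S p.
Proof.
move=> hS xpy; have [Sxp hxp] := segment_exists x p; have [Spz hpz] := segment_exists p y.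
have [g [gi g0 gl eS]] := hS.
have xl : 0 <= d x p <= d x y by rewrite mdist_ge0 /= -xpy lerDl mdist_ge0.
set u := g (d x p).
have Su : S u by rewrite eS; exists (d x p) => //=; rewrite in_itv.
have xu : d x u = d x p.
  have h0 : 0 <= (0 : R) <= d x y by rewrite lexx mdist_ge0.
  by rewrite /u -{1}g0 (gi _ _ h0 xl) sub0r normrN ger0_norm ?mdist_ge0.
have uz := segment_between hS Su.
suff <- : u = p by [].
have [/(segment_between hxp)|/(segment_between hpz)] := HT.2 _ _ _ _ _ _ hxp hpz hS _ Su;
  rewrite /between => e; apply: mdist0_eq.
  by rewrite xu in e; lra.
rewrite metric_sym; move: e uz xpy; rewrite /between xu; lra.
Qed.

(** The tree condition on triangles in terms of betweenness, the form used from here on. *)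
Lemma between_split x p z y : between x p z -> between x p y \/ between y p z.
Proof.
move=> xpz; have [Sxy hxy] := segment_exists x y.
have [Syz hyz] := segment_exists y z; have [Sxz hxz] := segment_exists x z.
have sub := between_segment hxz xpz.
by have [/(segment_between hxy)|/(segment_between hyz)] :=
  HT.2 _ _ _ _ _ _ hxy hyz hxz _ sub; [left|right].
Qed.

End Betweenness.

(** * Ancestry order and meets *)

Section RootedTree.
Context {R : realType} {T : metricType R} (HT : @is_Rtree R T) (r : T).
Local Notation d := (@mdist R T).

Definition height (x : T) : R := d r x.
Local Notation h := height.

(** Ancestry, made boolean so that it can filter finite sums. *)
Definition below (a b : T) : bool := d a b == h b - h a.

Lemma height_root : h r = 0. Proof. exact: mdistxx. Qed.

Lemma height_ge0 x : 0 <= h x. Proof. exact: mdist_ge0. Qed.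

Lemma height_lip x y : `|h x - h y| <= d x y. Proof. exact: mdist_lip. Qed.

Lemma belowP a b : reflect (d a b = h b - h a) (below a b).
Proof. exact: eqP. Qed.

Lemma below_between a b : below a b <-> between r a b.
Proof.
by rewrite /between -/(h a) -/(h b); split => [/belowP ->|e]; [|apply/belowP]; lra.
Qed.

Lemma belowxx a : below a a. Proof. by apply/belowP; rewrite mdistxx subrr. Qed.

Lemma root_below a : below r a.
Proof. by apply/belowP; rewrite height_root subr0. Qed.

Lemma below_height a b : below a b -> h a <= h b.
Proof. by move/belowP => e; rewrite -subr_ge0 -e mdist_ge0. Qed.

Lemma below_eq a b : below a b -> h b <= h a -> a = b.
Proof. by move/belowP => e hh; apply: mdist0_eq; lra. Qed.

Lemma below_anti a b : below a b -> below b a -> a = b.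
Proof. by move=> ab ba; apply: below_eq ab _; exact: below_height. Qed.

Lemma below_trans b a c : below a b -> below b c -> below a c.
Proof.
move=> /belowP ab /belowP bc; apply/belowP/eqP; rewrite eq_le.
have := metric_triangle a b c; have := height_lip c a.
by rewrite metric_sym ler_norml => /andP[_ h1] h2; apply/andP; split; lra.
Qed.

(** Splitting at [b] the segment from the root to [c], on which [a] lies, puts [a] either below [b]
    or between [b] and [c]; in the second case the heights force [a = b]. *)
Lemma below_chain c a b : below a c -> below b c -> h a <= h b -> below a b.
Proof.
move=> ac /belowP bc hab.
case: (between_split HT b ((below_between _ _).1 ac)) => [/below_between//|].
move/belowP: ac => ac; rewrite /between ac bc => e.
have -> : b = a by apply: mdist0_eq; lra.
exact: belowxx.
Qed.

Lemma below_total c a b : below a c -> below b c -> below a b || below b a.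
Proof.
move=> ac bc; case: (leP (h a) (h b)) => hab; first by rewrite (below_chain ac bc).
by rewrite (below_chain bc ac (ltW hab)) orbT.
Qed.

Lemma below_point c (t : R) : 0 <= t <= h c -> exists p, below p c /\ h p = t.
Proof.
by move=> /(tree_point HT)[p [rpc hp]]; exists p; split => //; apply/below_between.
Qed.

Lemma meet_exists x y : exists m,
  [/\ below m x, below m y & d x y = h x + h y - 2 * h m].
Proof.
(* The Gromov product of [x] and [y] at the root: the only height compatible with the distance
   formula. *)
set t := (h x + h y - d x y) / 2.
have := height_lip x y; rewrite ler_norml => /andP[l1 l2].
have l3 := metric_triangle x r y; rewrite (metric_sym x r) -!/(height _) in l3.
have [|m [mx hm]] := @below_point x t; first by rewrite /t; apply/andP; split; lra.
have my : below m y.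
  move/belowP: (mx) => emx.
  case: (between_split HT y ((below_between _ _).1 mx)) => [/below_between//|].
  rewrite /between emx (metric_sym y x) => e; apply/belowP.
  rewrite metric_sym; move: e hm; rewrite /t; lra.
by exists m; split => //; rewrite hm /t; lra.
Qed.

Definition meet (x y : T) : T := projT1 (cid (meet_exists x y)).

Lemma meetP x y :
  [/\ below (meet x y) x, below (meet x y) y & d x y = h x + h y - 2 * h (meet x y)].
Proof. exact: (projT2 (cid (meet_exists x y))). Qed.

Lemma meetl x y : below (meet x y) x. Proof. by case: (meetP x y). Qed.
Lemma meetr x y : below (meet x y) y. Proof. by case: (meetP x y). Qed.
Lemma mdist_meet x y : d x y = h x + h y - 2 * h (meet x y).
Proof. by case: (meetP x y). Qed.

Lemma below_meet c x y : below c (meet x y) = below c x && below c y.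
Proof.
apply/idP/andP => [cm|[cx cy]].
  by split; apply: below_trans cm _; rewrite ?meetl ?meetr.
apply: (below_chain cx (meetl _ _)).
have := metric_triangle x c y; rewrite (metric_sym x c) mdist_meet.
by rewrite (belowP _ _ cx) (belowP _ _ cy); lra.
Qed.

(** A point is determined by its ancestors; with [below_meet], identities between meets become
    boolean identities. *)
Lemma below_ext a b : (forall c, below c a = below c b) -> a = b.
Proof. by move=> e; apply: below_anti; [rewrite -e|rewrite e]; exact: belowxx. Qed.

Lemma meetC x y : meet x y = meet y x.
Proof. by apply: below_ext => c; rewrite !below_meet andbC. Qed.

Lemma meetA x y z : meet x (meet y z) = meet (meet x y) z.
Proof. by apply: below_ext => c; rewrite !below_meet andbA. Qed.

Lemma meetxx x : meet x x = x.
Proof. by apply: below_ext => c; rewrite below_meet andbb. Qed.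

Lemma meet_below x y : below x y -> meet x y = x.
Proof. by move=> xy; apply: below_anti; rewrite ?meetl// below_meet belowxx. Qed.

(** [meet x y] and [meet x z] are both ancestors of [x], hence comparable, and the lower one is the
    meet of all three points. *)
Lemma meet3 x y z : meet (meet x y) z = meet x y \/ meet (meet x y) z = meet x z.
Proof.
case/orP: (below_total (meetl x y) (meetl x z)) => e; [left|right].
  by rewrite meet_below // (below_trans e (meetr _ _)).
rewrite -(meet_below e) [RHS]meetC.
by apply: below_ext => c; rewrite !below_meet; case: (below c x) => //=; rewrite andbT.
Qed.

End RootedTree.

(** * Finite meet-closed subsets *)

Section ScalarBounds.
Context {R : realType}.

Lemma tanh_half_ge (x : R) : 0 <= x ->
  x / 2 * (1 - x / 2) <= (expR x - 1) / (expR x + 1).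
Proof.
move=> x0; have e1 := expR_ge1Dx x; have e0 := expR_gt0 x.
rewrite ler_pdivlMr ?addr_gt0//.
(* With denominators cleared, [expR x] has the positive coefficient [1 - x / 2 + x ^+ 2 / 4];
   replacing it by its lower bound [1 + x] leaves the slack [x ^+ 3 / 4]. *)
have : 0 <= (expR x - 1 - x) * (1 - x / 2 + x ^+ 2 / 4).
  by rewrite mulr_ge0; [|lra|nra].
have : 0 <= x ^+ 3 by rewrite exprn_ge0.
rewrite !exprS expr0; nra.
Qed.

Lemma tanh_half_le (x : R) : 0 <= x -> (expR x - 1) / (expR x + 1) <= x / 2.
Proof.
move=> x0; rewrite ler_pdivrMr ?addr_gt0 ?expR_gt0//.
(* The cleared inequality is [0 <= f x]. Here [f 0 = 0], and the derivative is nonnegative because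
   [1 - t <= expR (- t)]. *)
pose f (t : R) := (t - 2) * expR t + t + 2.
suff : 0 <= f x by rewrite /f; lra.
have -> : 0 = f 0 by rewrite /f expR0; lra.
have df (t : R) : is_derive t 1 f ((t - 1) * expR t + 1).
  rewrite /f; apply: is_derive_eq => /=.
  rewrite /GRing.scale /=; ring.
case: (eqVneq x 0) => [->//|xn0].
have xp : 0 < x by rewrite lt_neqAle eq_sym xn0.
have cf : {within `[0, x], continuous f}.
  apply: derivable_within_continuous => t _; exact: ex_derive.
have [c /andP[c0 cx] e] := MVT xp (fun t _ => df t) cf.
rewrite -subr_ge0 e mulr_ge0 ?subr0//.
have : 1 - c <= expR (- c) by have := expR_ge1Dx (- c).
rewrite expRN -(ler_pM2r (expR_gt0 c)) mulVf ?gt_eqF ?expR_gt0//; lra.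
Qed.

(** The quotient is [tanh ((a - b) / 2)], as dividing through by [expR b] shows. *)
Lemma tanh_half_bounds (a b : R) : b <= a ->
  (a - b) / 2 * (1 - (a - b) / 2) <= (expR a - expR b) / (expR a + expR b)
    <= (a - b) / 2.
Proof.
move=> ba; have -> : (expR a - expR b) / (expR a + expR b)
    = (expR (a - b) - 1) / (expR (a - b) + 1).
  have := expR_gt0 a; have := expR_gt0 b; have := expR_gt0 (a - b) => *.
  have -> : expR a = expR (a - b) * expR b by rewrite -expRD subrK.
  field; apply/andP; split; apply: lt0r_neq0; nra.
by rewrite tanh_half_ge ?tanh_half_le// subr_ge0.
Qed.

End ScalarBounds.

(** * Parents and telescoping sums *)

Section FiniteSubtree.
Context {R : realType} {T : metricType R} (HT : @is_Rtree R T) (r : T).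
Local Notation d := (@mdist R T).
Local Notation h := (height r).
Local Notation below := (below r).
Local Notation meet := (meet HT r).

Lemma argmax_foldr (s : seq T) (m0 : T) :
  let m := foldr (fun q m => if h m <= h q then q else m) m0 s in
  m \in m0 :: s /\ (forall q, q \in m0 :: s -> h q <= h m).
Proof.
elim: s => [|a s [IHm IH]] /=; first by rewrite mem_head; split => // q /[!inE] /eqP ->.
set m := foldr _ _ _ in IHm IH *.
case: ifPn => [ma|]; last rewrite -ltNge => am.
  split=> [|q]; rewrite !inE ?eqxx ?orbT// => /or3P[/eqP->|/eqP->//|qs].
    by apply: le_trans ma; rewrite IH// mem_head.
  by apply: le_trans ma; rewrite IH// inE qs orbT.
split=> [|q].
  by move: IHm; rewrite !inE => /orP[->//|->]; rewrite !orbT.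
rewrite !inE => /or3P[/eqP->|/eqP->|qs]; [|exact: ltW|].
  by rewrite IH// mem_head.
by rewrite IH// inE qs orbT.
Qed.

Context (F : seq T) (uF : uniq F) (rF : r \in F).

(** The highest strict ancestor of [p] in [F]. The default [r] is an ancestor of every point and is
    the value at [p = r]. *)
Definition parent (p : T) : T :=
  foldr (fun q m => if h m <= h q then q else m) r
        [seq q <- F | below q p && (q != p)].

Lemma parent_in p : parent p \in F.
Proof.
have [+ _] := argmax_foldr [seq q <- F | below q p && (q != p)] r.
by rewrite -/(parent p) inE mem_filter => /orP[/eqP->//|/andP[_ ->]].
Qed.

Lemma parent_below p : below (parent p) p.
Proof.
have [+ _] := argmax_foldr [seq q <- F | below q p && (q != p)] r.
rewrite -/(parent p) inE mem_filter => /orP[/eqP->|/andP[/andP[-> _] _]//].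
exact: root_below.
Qed.

Lemma parent_neq p : p != r -> parent p != p.
Proof.
move=> pr; have [+ _] := argmax_foldr [seq q <- F | below q p && (q != p)] r.
by rewrite -/(parent p) inE mem_filter => /orP[/eqP->|/andP[/andP[_ ->] _]//]; rewrite eq_sym.
Qed.

Lemma parent_max p q : q \in F -> below q p -> q != p -> below q (parent p).
Proof.
move=> qF qp nqp; apply: (below_chain HT qp (parent_below p)).
have [_] := argmax_foldr [seq q <- F | below q p && (q != p)] r; apply.
by rewrite inE mem_filter qp nqp qF orbT.
Qed.

Lemma parent_height p : h (parent p) <= h p.
Proof. exact/below_height/parent_below. Qed.

(** The root behaves as if it had a parent where [f] vanishes, so that sums telescope to [f x]
    rather than to [f x - f r]. *)
Definition increment (f : T -> R) (p : T) : R :=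
  f p - if p == r then 0 else f (parent p).

(** Strong induction on the number of ancestors of [x] in [F]: those other than [x] are exactly the
    ancestors of [parent x]. *)
Lemma telescope (f : T -> R) (x : T) : x \in F ->
  \sum_(p <- F | below p x) increment f p = f x.
Proof.
have [n] := ubnP (size [seq p <- F | below p x]).
elim: n x => // n IH x; rewrite ltnS => sx xF.
have xx := belowxx r x.
rewrite big_mkcond (bigD1_seq x)//= xx.
have -> : \sum_(p <- F | p != x) (if below p x then increment f p else 0)
   = if x == r then 0 else f (parent x).
  case: ifPn => [/eqP xr|xr].
    rewrite big1_seq// => p /andP[px _]; case: ifPn => // pbx.
    by move: px; rewrite (below_anti pbx) ?eqxx// xr root_below.
  rewrite -big_mkcondr /=.
  have e p : p \in F -> (p != x) && below p x = below p (parent x).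
    move=> pF; apply/andP/idP => [[px pbx]|pq]; first exact: parent_max.
    split; last exact: below_trans pq (parent_below x).
    apply: contra (parent_neq xr) => /eqP px; apply/eqP.
    by apply: below_anti (parent_below x) _; rewrite -{1}px.
  rewrite big_seq_cond (eq_bigl (fun p => (p \in F) && below p (parent x))); last first.
    by move=> p /=; case: (boolP (p \in F)) => //= /e ->.
  rewrite -big_seq_cond IH ?parent_in//.
  (* The count drops strictly, since [x] itself is an ancestor of [x]. *)
  apply: leq_trans sx; rewrite !size_filter.
  rewrite -(@eq_in_count _ (fun p => (p != x) && below p x)) //.
  rewrite -!sum1_count big_mkcond [X in (_ < X)%N]big_mkcond.
  rewrite !(bigD1_seq x xF uF)/= eqxx xx /= add0n add1n ltnS.
  by apply: leq_sum => p _; case: (below p x); rewrite ?andbF//; case: (_ != _).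
by rewrite /increment subrK.
Qed.

End FiniteSubtree.

(** * The magnitude of a finite meet-closed set *)

Section FiniteMagnitude.
Context {R : realType} {T : metricType R} (HT : @is_Rtree R T) (r : T).
Local Notation d := (@mdist R T).
Local Notation h := (height r).
Local Notation below := (below r).
Local Notation meet := (meet HT r).
Context (F : seq T) (uF : uniq F) (rF : r \in F).
Context (mF : {in F &, forall x y, meet x y \in F}).
Local Notation parent := (parent r F).
Local Notation inc := (increment r F).

Let e1 (x : T) : R := expR (h x).
Let e2 (x : T) : R := expR (h x) ^+ 2.
(** The value of [e1] at the parent, with the convention of [increment] at the root. Thus
    [inc e1 = e1 - e0] and [inc e2] is the difference of their squares, which is why [B] turns
    [inc e2] into [inc e1]. *)
Let e0 (p : T) : R := if p == r then 0 else e1 (parent p).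
Let B (p : T) : R := (e1 p + e0 p)^-1.

(* The root contributes [1], any other [p] contributes [tanh ((h p - h (parent p)) / 2)]. *)
Definition tree_magnitude : R := \sum_(p <- F) inc e1 p / (e1 p + e0 p).
Local Notation M := tree_magnitude.

Let e1_gt0 x : 0 < e1 x. Proof. exact: expR_gt0. Qed.

Let e0_ge0 p : 0 <= e0 p.
Proof. by rewrite /e0; case: ifP => // _; exact: ltW. Qed.

Let e0_le p : e0 p <= e1 p.
Proof.
by rewrite /e0; case: ifP => _; [exact: ltW|rewrite ler_expR parent_height].
Qed.

Let den_gt0 p : 0 < e1 p + e0 p.
Proof. by rewrite ltr_pwDl. Qed.

Let increment_e1 p : inc e1 p = e1 p - e0 p. Proof. by []. Qed.

Let increment_e2 p : inc e2 p = (e1 p - e0 p) * (e1 p + e0 p).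
Proof.
by rewrite -subr_sqr /increment /e2 /e0 /e1; case: ifP; rewrite ?expr0n ?subr0.
Qed.

Let increment_B p : inc e2 p * B p = inc e1 p.
Proof. by rewrite increment_e2 mulfK// gt_eqF. Qed.

Let increment_e2_ge0 p : 0 <= inc e2 p.
Proof. by rewrite increment_e2 mulr_ge0 ?subr_ge0// ltW. Qed.

Lemma exp_mdist x y : expR (- d x y) = (e1 x)^-1 * (e1 y)^-1 * e2 (meet x y).
Proof.
rewrite (mdist_meet HT r) /e1 /e2 -!expRN -expRM_natl -!expRD.
by congr expR; rewrite -mulr_natl; ring.
Qed.

(** The ancestors of [meet x y] are the common ancestors of [x] and [y]. Telescoping [e2] over them
    writes the kernel as a sum of rank one kernels with coefficients [inc e2 p >= 0]. *)
Lemma exp_mdistE x y : x \in F -> y \in F -> expR (- d x y) =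
  \sum_(p <- F | below p x && below p y) (e1 x)^-1 * (e1 y)^-1 * inc e2 p.
Proof.
move=> xF yF; rewrite exp_mdist -mulr_sumr -(telescope HT uF rF e2 (mF xF yF)).
by congr (_ * _); apply: eq_bigl => p; rewrite below_meet.
Qed.

Lemma tree_magnitude_ge1 : 1 <= M.
Proof.
rewrite /M (bigD1_seq r)//= increment_e1 /e0 eqxx subr0 addr0 divff ?gt_eqF//.
by rewrite lerDl sumr_ge0// => p _; rewrite divr_ge0 ?(ltW (den_gt0 _))// increment_e1 subr_ge0.
Qed.

(* The energy is [W = sum_p c_p A_p ^ 2] with [c_p = inc e2 p >= 0], the mass is
   [S = sum_p c_p B_p A_p], and [M = sum_p c_p B_p ^ 2]. *)
Lemma tree_cauchy_schwarz (s : seq (R * T)) : {in s, forall k, k.2 \in F} ->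
  (\sum_(k <- s) k.1) ^+ 2 <=
  (\sum_(k <- s) \sum_(l <- s) k.1 * l.1 * expR (- d k.2 l.2)) * M.
Proof.
move=> sF; set S := \sum_(k <- s) k.1; set W := \sum_(k <- s) _.
pose A p := \sum_(k <- s | below p k.2) k.1 * (e1 k.2)^-1.
have eW : W = \sum_(p <- F) inc e2 p * A p ^+ 2.
  transitivity (\sum_(k <- s) \sum_(l <- s) \sum_(p <- F | below p k.2 && below p l.2)
      inc e2 p * ((k.1 * (e1 k.2)^-1) * (l.1 * (e1 l.2)^-1))).
    rewrite /W !big_seq; apply: eq_bigr => k ks; rewrite !big_seq.
    apply: eq_bigr => l ls; rewrite exp_mdistE ?sF// mulr_sumr.
    by apply: eq_bigr => p _; ring.
  under eq_bigr do under eq_bigr do rewrite big_mkcond.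
  under eq_bigr do rewrite exchange_big /=.
  rewrite exchange_big /=; apply: eq_bigr => p _.
  rewrite expr2 /A big_distrlr /= mulr_sumr [RHS]big_mkcond; apply: eq_bigr => k _.
  case: (below p k.2); last by rewrite big1.
  by rewrite mulr_sumr [RHS]big_mkcond.
have eS : S = \sum_(p <- F) inc e1 p * A p.
  transitivity (\sum_(k <- s) \sum_(p <- F | below p k.2)
     inc e1 p * (k.1 * (e1 k.2)^-1)).
    rewrite /S !big_seq; apply: eq_bigr => k ks; rewrite -mulr_suml.
    by rewrite (telescope HT uF rF e1 (sF _ ks)) mulrCA divff ?mulr1// gt_eqF.
  under eq_bigr do rewrite big_mkcond.
  rewrite exchange_big /=; apply: eq_bigr => p _.
  by rewrite /A mulr_sumr [RHS]big_mkcond.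
have M0 : 0 < M := lt_le_trans ltr01 tree_magnitude_ge1.
(* Expanded, this sum is [M ^+ 2 * W - 2 * M * S ^+ 2 + S ^+ 2 * M], that is,
   [M * (W * M - S ^+ 2)]. *)
have : 0 <= \sum_(p <- F) inc e2 p * (M * A p - S * B p) ^+ 2.
  by rewrite sumr_ge0// => p _; rewrite mulr_ge0// sqr_ge0.
have -> (a b : R) : \sum_(p <- F) inc e2 p * (a * A p - b * B p) ^+ 2
    = a ^+ 2 * (\sum_(p <- F) inc e2 p * A p ^+ 2)
      - 2 * a * b * (\sum_(p <- F) inc e1 p * A p)
      + b ^+ 2 * (\sum_(p <- F) inc e1 p * B p).
  rewrite !mulr_sumr -sumrB -big_split /=; apply: eq_bigr => p _.
  by rewrite -increment_B; ring.
rewrite -eW -eS -/M.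
move=> q; rewrite -subr_ge0 -(pmulr_rge0 _ M0).
by apply: le_trans q _; rewrite le_eqVlt; apply/orP; left; apply/eqP; ring.
Qed.

(* The measure achieving equality in [tree_cauchy_schwarz]: it has [A_p = B_p]. *)
Definition tree_weight : seq (R * T) :=
  [seq (B p * e1 p, p) | p <- F] ++ [seq (- (B p * e0 p), parent p) | p <- F].

Lemma tree_weight_mass : \sum_(k <- tree_weight) k.1 = M.
Proof.
rewrite big_cat !big_map /= sumrN -sumrB; apply: eq_bigr => p _.
by rewrite increment_e1 -mulrBr mulrC.
Qed.

Lemma tree_weight_in : {in tree_weight, forall k, k.2 \in F}.
Proof.
move=> k; rewrite mem_cat => /orP[] /mapP[p pF ->] //=; exact: parent_in.
Qed.

(** As [p] is not below [y], the point [meet p y] of [F] is a strict ancestor of [p], hence an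
    ancestor of [parent p]. *)
Lemma meet_parent p y : p \in F -> y \in F -> ~~ below p y ->
  meet (parent p) y = meet p y.
Proof.
move=> pF yF npy; apply: (below_ext (r := r)) => c; rewrite !below_meet.
apply/andP/andP => -[cp cy]; split => //; first exact: below_trans cp (parent_below _ _ _).
have cm : below c (meet p y) by rewrite below_meet cp.
apply: below_trans cm _; apply: (parent_max HT) => //; rewrite ?meetl ?mF//.
by apply: contraNneq npy => <-; exact: meetr.
Qed.

(** By [meet_parent] the two atoms coming from [p] cancel at [y] unless [p] is below [y], and then
    they contribute [inc e1 p / e1 y]. These terms telescope to 1. *)
Lemma tree_weight_potential y : y \in F ->
  \sum_(k <- tree_weight) k.1 * expR (- d k.2 y) = 1.
Proof.
move=> yF; rewrite big_cat !big_map /= -big_split /=.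
transitivity ((e1 y)^-1 * \sum_(p <- F | below p y) inc e1 p); last first.
  by rewrite (telescope HT uF rF) // mulVf// gt_eqF.
rewrite mulr_sumr [RHS]big_mkcond !big_seq; apply: eq_bigr => p pF.
rewrite !exp_mdist -increment_B increment_e2.
have n1 := lt0r_neq0 (e1_gt0 p); have n2 := lt0r_neq0 (e1_gt0 y).
have -> : - (B p * e0 p) * ((e1 (parent p))^-1 * (e1 y)^-1 * e2 (meet (parent p) y))
   = if p == r then 0 else - (B p * ((e1 y)^-1 * e2 (meet (parent p) y))).
  rewrite /e0; case: ifP => _; first by rewrite mulr0 oppr0 mul0r.
  by have n3 := lt0r_neq0 (e1_gt0 (parent p)); field; rewrite n2 n3.
have -> : B p * e1 p * ((e1 p)^-1 * (e1 y)^-1 * e2 (meet p y))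
   = B p * ((e1 y)^-1 * e2 (meet p y)) by field; rewrite n1 n2.
case: ifPn => pr; first rewrite addr0.
  rewrite (eqP pr) root_below (meet_below HT (root_below _ _)) /e0 eqxx.
  by rewrite subr0 addr0 /e2 -/(e1 r); ring.
case: ifPn => py; last first.
  by rewrite meet_parent// subrr.
rewrite (meet_below HT py) (meet_below HT (below_trans (parent_below _ _ _) py)).
by rewrite /e0 (negbTE pr) /e2 -!/(e1 _); ring.
Qed.

Lemma tree_weight_energy :
  \sum_(k <- tree_weight) \sum_(l <- tree_weight) k.1 * l.1 * expR (- d k.2 l.2) = M.
Proof.
rewrite -tree_weight_mass !big_seq; apply: eq_bigr => k kw.
transitivity (k.1 * \sum_(l <- tree_weight) l.1 * expR (- d l.2 k.2)).
  by rewrite mulr_sumr; apply: eq_bigr => l _; rewrite metric_sym mulrA.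
by rewrite tree_weight_potential ?mulr1// tree_weight_in.
Qed.

Definition tree_length : R := \sum_(p <- F | p != r) (h p - h (parent p)).

Let magnitude_split : M = 1 + \sum_(p <- F | p != r)
  (expR (h p) - expR (h (parent p))) / (expR (h p) + expR (h (parent p))).
Proof.
rewrite /M (bigD1_seq r)//= increment_e1 /e0 eqxx subr0 addr0 divff ?gt_eqF//.
by congr (_ + _); apply: eq_bigr => p pr; rewrite /increment (negbTE pr).
Qed.

Lemma tree_magnitude_le : M <= 1 + tree_length / 2.
Proof.
rewrite magnitude_split lerD2l mulr_suml; apply: ler_sum => p _.
by have /andP[] := tanh_half_bounds (parent_height r F p).
Qed.

Lemma tree_magnitude_ge (e : R) : {in F, forall p, p != r -> h p - h (parent p) <= e} ->
  1 + tree_length / 2 * (1 - e / 2) <= M.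
Proof.
move=> mesh; rewrite magnitude_split lerD2l !mulr_suml big_seq_cond [leRHS]big_seq_cond.
apply: ler_sum => p /andP[pF pr].
have /andP[+ _] := tanh_half_bounds (parent_height r F p); apply: le_trans.
rewrite ler_wpM2l ?divr_ge0 ?subr_ge0 ?parent_height//.
by rewrite lerD2l lerN2 ler_pM2r ?invr_gt0// mesh.
Qed.

End FiniteMagnitude.

(** * Energy of signed measures *)

Section IntegralPartition.
Context d0 (X : measurableType d0) (R : realType).

(** Induction on [n], splitting off one cell at a time; on the cell [A i] the error is the integral
    of a function bounded by [e]. *)
Lemma Rintegral_partition (m : {finite_measure set X -> \bar R}) (f : X -> R)
    (A : nat -> set X) (c : nat -> R) (e : R) (n : nat) :
  m.-integrable setT (EFin \o f) -> (forall i, measurable (A i)) ->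
  trivIset setT A -> (forall i x, A i x -> `|f x - c i| <= e) ->
  `|Rintegral m (\big[setU/set0]_(i < n) A i) f - \sum_(i < n) c i * fine (m (A i))|
    <= e * fine (m (\big[setU/set0]_(i < n) A i)).
Proof.
move=> intf mA tA fc; elim: n => [|n IH].
  by rewrite !big_ord0 Rintegral_set0 measure0 subrr normr0 mulr0.
rewrite !big_ord_recr /=.
set U := \big[setU/set0]_(i < n) A i in IH *; set s := \sum_(i < n) _ in IH *.
have mU : measurable U by exact: bigsetU_measurable.
have UA : U `&` A n = set0.
  rewrite -subset0 => x []; rewrite /U -bigcup_mkord => -[i /= ni Ax] Anx.
  by have e' := tA i n I I (ex_intro _ x (conj Ax Anx)); rewrite e' ltnn in ni.
have dUA : [disjoint U & A n] by apply/disj_setPS; rewrite UA.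
have intS S : measurable S -> m.-integrable S (EFin \o f).
  by move=> mS; apply: integrableS intf.
have finS S : measurable S -> m S \is a fin_num by move=> mS; exact: fin_num_measure.
rewrite Rintegral_setU//; last by apply: intS; exact: measurableU.
rewrite measureU// fineD ?finS// mulrDr opprD addrACA.
apply: le_trans (ler_normD _ _) _; apply: lerD => //.
have intc (a : R) : m.-integrable (A n) (EFin \o cst a).
  by apply: finite_measure_integrable_cst.
rewrite -Rintegral_cst// -RintegralB; [|exact: mA|exact: intS|exact: intc].
apply: le_trans (le_normr_Rintegral _ _) _ => //.
  have -> : EFin \o (fun x => f x - c n)%R = ((EFin \o f) \- (EFin \o cst (c n)))%E by [].
  by apply: integrableB => //; exact: intS.
rewrite -Rintegral_cst//; apply: le_Rintegral => //.
- have -> : EFin \o (fun x => `|f x - c n|)%R =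
     (abse \o ((EFin \o f) \- (EFin \o cst (c n))))%E by [].
  by apply: integrable_abse; apply: integrableB => //; exact: intS.
- exact: intc.
- by move=> x; exact: fc.
Qed.

End IntegralPartition.

(** * Lipschitz functions and Riemann sums for charges *)

Section ChargeIntegral.
Context {R : realType} {T : metricType R} (x0 : T).
Local Notation d := (@mdist R T).
Local Notation X := (borel T x0).

Definition lipschitz_fun (K : R) (f : T -> R) :=
  forall x y, `|f x - f y| <= K * d x y.

Lemma open_superlevel K f (a : R) : lipschitz_fun K f -> open [set y : T | a < f y].
Proof.
move=> fK; rewrite openE => y /= ay; apply/nbhs_ballP.
(* [K] may have any sign or vanish, so the radius is divided by this larger positive constant. *)
have K0 : 0 < `|K| + 1 by rewrite ltr_pwDr.
exists ((f y - a) / (`|K| + 1)) => /=; first by rewrite divr_gt0// subr_gt0.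
move=> z; rewrite ballEmdist /= ltr_pdivlMr// => yz.
have := fK y z; rewrite ler_norml => /andP[_ h].
have : K * d y z <= d y z * (`|K| + 1).
  by rewrite mulrC ler_wpM2l ?mdist_ge0//; have := ler_norm K; lra.
lra.
Qed.

Lemma open_mdist_lt x (e : R) : open [set y : T | d x y < e].
Proof.
rewrite [X in open X](_ : _ = [set y | - e < - d x y]); last first.
  by apply/seteqP; split => y /=; rewrite ltrN2.
apply: (@open_superlevel 1) => y z.
by rewrite mul1r -opprD normrN; exact: mdist_lip.
Qed.

(** The centre [x i] need not lie in its cell, and cells may be empty. *)
Definition fine_partition (e : R) (n : nat) (x : nat -> T) (A : nat -> set X) :=
  [/\ forall i, measurable (A i), trivIset setT A,
      \big[setU/set0]_(i < n) A i = setT & forall i y, A i y -> d (x i) y <= e].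

(** Finitely many balls of radius [e] cover the space; removing from each the earlier ones makes
    them disjoint. *)
Lemma exists_fine_partition (e : R) : compact [set: T] -> 0 < e ->
  exists n x A, fine_partition e n x A.
Proof.
(* [compact_cover] is only available on pointed spaces. *)
move=> cT e0; pose isp := isPointed.Build T x0.
pose pT : ptopologicalType := HB.pack_for ptopologicalType (Metric.sort T) (Metric.class T) isp.
have : @compact pT [set: T] by []; rewrite compact_cover.
move=> /(_ T setT (fun x => [set y | d x y < e])) [].
- by move=> i _; exact: open_mdist_lt.
- by move=> y _; exists y => //=; rewrite mdistxx.
move=> D _ Dcov; pose s : seq T := finmap.enum_fset D; pose x i := nth x0 s i.
pose U i : set X := [set y | d (x i) y < e].
exists (size s), x, (seqDU U); split.
- apply: seqDU_measurable => i; apply: sub_sigma_algebra.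
  exact: open_mdist_lt.
- exact: trivIset_seqDU.
- rewrite -bigsetU_seqDU -subTset => y _.
  have [z /= zD zy] := Dcov y I; rewrite -bigcup_mkord.
  by exists (index z s) => /=; rewrite ?index_mem// /U/= /x nth_index.
- by move=> i y [] /ltW.
Qed.

Lemma lipschitz_measurable K (f : X -> R) : lipschitz_fun K f -> measurable_fun setT f.
Proof.
move=> fK; apply: (measurability _ (measurable_realfun.RGenOInfty.measurableE R)).
move=> _ [_ [a ->] <-]; rewrite setTI; apply: sub_sigma_algebra => /=.
rewrite [X in open X](_ : _ = [set y : T | a < f y]); last first.
  by apply/seteqP; split => y /=; rewrite in_itv/= andbT.
exact: open_superlevel fK.
Qed.

Lemma fine_partition_ex e n x A y : fine_partition e n x A ->
  exists i, (i < n)%N /\ A i y.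
Proof.
case=> _ _ AT _; have : [set: X] y by [].
by rewrite -AT -bigcup_mkord => -[i /= ni Aiy]; exists i.
Qed.

Lemma sum_fine_partition (m : {finite_measure set X -> \bar R}) e n x A :
  fine_partition e n x A -> \sum_(i < n) fine (m (A i)) = fine (m setT).
Proof.
case=> mA tA AT _; rewrite -AT measure_semi_additive_ord_I ?AT//.
  by rewrite -sum_fine// => i _; exact: fin_num_measure.
exact: sub_trivIset tA.
Qed.

Section FixedCharge.
Context (cT : compact [set: T]) (mu : {charge set X -> \bar R}).
Let pos := jordan_pos (hahnPN mu).
Let neg := jordan_neg (hahnPN mu).

Definition variation_mass : R := fine (pos setT) + fine (neg setT).
Local Notation mass := variation_mass.
Definition rcintegral (f : T -> R) : R := Rintegral pos setT f - Rintegral neg setT f.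

Lemma variation_mass_ge0 : 0 <= mass.
Proof. by rewrite addr_ge0// fine_ge0. Qed.

(** The Jordan parts of [A] are, up to sign, the charges of its intersections with the two Hahn
    sets. *)
Lemma fine_jordan A : measurable A -> fine (mu A) = fine (pos A) - fine (neg A).
Proof.
move=> mA; have [[mP _] [mN _] PNT PN0] := hahnPN mu.
have -> : pos A = mu (A `&` hahnP mu).
  by rewrite /pos jordan_posE cjordan_posE /crestr0 mem_set.
have -> : neg A = (- mu (A `&` hahnN mu))%E.
  by rewrite /neg jordan_negE cjordan_negE /crestr0 mem_set.
rewrite (charge_partition mu mA mP mN PNT PN0) fineN opprK fineD//.
  by apply: fin_num_measure; exact: measurableI.
by apply: fin_num_measure; exact: measurableI.
Qed.

Lemma sum_charge_partition e n x A : fine_partition e n x A ->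
  \sum_(i < n) fine (mu (A i)) = fine (mu setT).
Proof.
move=> P; have [mA _ _ _] := P; rewrite fine_jordan//.
under eq_bigr do rewrite fine_jordan//.
by rewrite sumrB !(sum_fine_partition _ P).
Qed.

Lemma lipschitz_integrable (m : {finite_measure set X -> \bar R}) K (f : X -> R) :
  0 <= K -> lipschitz_fun K f -> m.-integrable setT (EFin \o f).
Proof.
move=> K0 fK; apply: measurable_bounded_integrable => //.
- by rewrite ltey_eq fin_num_measure.
- exact: lipschitz_measurable fK.
(* A partition of mesh 1 bounds [f]: it differs by at most [K] from its value at one of finitely
   many centres. *)
have [n [x [A P]]] := exists_fine_partition cT ltr01.
exists (\sum_(i < n) `|f (x i)| + K); split; first exact: num_real.
move=> M /ltW le_M y _ /=; apply: le_trans le_M.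
have [i [ni Ai]] := fine_partition_ex y P; have [_ _ _ /(_ _ _ Ai) xy] := P.
rewrite -[f y](subrK (f (x i))) addrC; apply: le_trans (ler_normD _ _) _; apply: lerD.
  by rewrite (bigD1 (Ordinal ni))//= lerDl sumr_ge0.
by apply: le_trans (fK _ _) _; rewrite metric_sym ler_piMr.
Qed.

Lemma cintegral_lipschitz K f : 0 <= K -> lipschitz_fun K f ->
  cintegral mu (fun x => (f x)%:E) = (rcintegral f)%:E.
Proof.
move=> K0 fK; rewrite /cintegral /rcintegral /Rintegral EFinB.
by rewrite !fineK//; apply: integrable_fin_num => //; exact: lipschitz_integrable fK.
Qed.

Lemma rcintegral_partition K f e n x A : 0 <= K -> lipschitz_fun K f ->
  fine_partition e n x A ->
  `|rcintegral f - \sum_(i < n) f (x i) * fine (mu (A i))| <= K * e * mass.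
Proof.
move=> K0 fK P; have [mA tA AT xA] := P.
have bnd (m : {finite_measure set X -> \bar R}) :
  `|Rintegral m setT f - \sum_(i < n) f (x i) * fine (m (A i))| <= K * e * fine (m setT).
  rewrite -AT; apply: (Rintegral_partition (c := fun i => f (x i))) => //.
    exact: lipschitz_integrable fK.
  move=> i y /xA xy; apply: le_trans (fK _ _) _.
  by rewrite metric_sym ler_wpM2l.
under eq_bigr do rewrite fine_jordan// mulrBr.
rewrite sumrB /rcintegral /variation_mass mulrDr.
have := bnd (jordan_neg (hahnPN mu)); have := bnd (jordan_pos (hahnPN mu)).
rewrite -/pos -/neg !ler_norml.
by move=> /andP[? ?] /andP[? ?]; apply/andP; split; lra.
Qed.

Lemma sum_abs_partition e n x A : fine_partition e n x A ->
  \sum_(i < n) `|fine (mu (A i))| <= mass.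
Proof.
move=> P; rewrite /variation_mass -!(sum_fine_partition _ P) -big_split /=.
apply: ler_sum => i _; have [mA _ _ _] := P; rewrite fine_jordan//.
apply: le_trans (ler_normB _ _) _.
by rewrite !ger0_norm// fine_ge0.
Qed.

(** Both integrals are close to Riemann sums over one common partition, and these differ by at most
    [c] times the sum of the absolute charges of the cells. *)
Lemma rcintegral_dist K f g c : 0 <= K -> lipschitz_fun K f -> lipschitz_fun K g ->
  0 <= c -> (forall x, `|f x - g x| <= c) ->
  `|rcintegral f - rcintegral g| <= c * mass.
Proof.
move=> K0 fK gK c0 fg; apply/ler_addgt0Pr => e e0.
have m0 := variation_mass_ge0.
(* This mesh makes the two errors [K * e' * mass] add up to at most [e]; the summand 1 keeps the
   denominator positive. *)
have e'0 : 0 < e / (2 * K * mass + 1).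
  by rewrite divr_gt0// ltr_pwDr// !mulr_ge0.
have [n [x [A P]]] := exists_fine_partition cT e'0.
have := rcintegral_partition K0 fK P; have := rcintegral_partition K0 gK P.
set e' := e / _ in e'0 P *; set sg := \sum_(i < n) _; set sf := \sum_(i < n) _.
have sfg : `|sf - sg| <= c * mass.
  rewrite -sumrB; apply: le_trans (ler_norm_sum _ _ _) _.
  apply: le_trans (_ : \sum_(i < n) c * `|fine (mu (A i))| <= _).
    by apply: ler_sum => i _; rewrite -mulrBl normrM ler_wpM2r.
  by rewrite -mulr_sumr ler_wpM2l// (sum_abs_partition P).
have : 2 * (K * e' * mass) <= e.
  have : e' * (2 * K * mass + 1) = e by rewrite /e' divfK// gt_eqF// ltr_pwDr// !mulr_ge0.
  nra.
move=> h1; rewrite !ler_norml in sfg *.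
by move=> /andP[? ?] /andP[? ?]; case/andP: sfg => *; apply/andP; split; lra.
Qed.

End FixedCharge.

End ChargeIntegral.

(** * Energy and its discretisation *)

Section Energy.
Context {R : realType} {T : metricType R} (x0 : T) (cT : compact [set: T]).
Local Notation d := (@mdist R T).
Local Notation X := (borel T x0).

Lemma expRN_lip (a b : R) : 0 <= a -> 0 <= b -> `|expR (- a) - expR (- b)| <= `|a - b|.
Proof.
wlog ab : a b / a <= b => [h a0 b0|a0 b0].
  case: (leP a b) => [ab|/ltW ba]; first exact: h.
  by rewrite distrC (distrC a); exact: h.
rewrite ger0_norm ?subr_ge0 ?ler_expR ?lerN2// ler0_norm ?subr_le0//.
(* The difference becomes [expR (- a) * (1 - expR (a - b))], whose first factor is at most 1 and
   whose second is at most [b - a]. *)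
have -> : expR (- b) = expR (- a) * expR (a - b) by rewrite -expRD; congr expR; ring.
have h1 : expR (- a) <= 1 by rewrite -expR0 ler_expR; lra.
have := expR_ge1Dx (a - b); have := expR_gt0 (- a); have := expR_gt0 (a - b).
set u := expR (- a) in h1 *; set v := expR _ => v0 u0 h2.
have v1 : v <= 1 by rewrite /v -expR0 ler_expR; lra.
have : u * (1 - v) <= 1 - v by rewrite ler_piMl// subr_ge0.
lra.
Qed.

Lemma kernel_lip x y z : `|expR (- d x y) - expR (- d x z)| <= d y z.
Proof. by apply: le_trans (mdist_lip x y z); rewrite expRN_lip ?mdist_ge0. Qed.

Lemma kernel_lipschitz y : lipschitz_fun 1 (fun x => expR (- d x y)).
Proof. by move=> x z; rewrite mul1r !(metric_sym _ y); exact: kernel_lip. Qed.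

Section FixedCharge.
Context (mu : {charge set X -> \bar R}).
Local Notation mass := (variation_mass mu).

Definition potential (y : T) : R := rcintegral mu (fun x => expR (- d x y)).

(** Moving from [y] to [z] changes the kernel by at most [d y z], uniformly in the other variable.
    This makes the outer integral of [W_inner] a finite real number. *)
Lemma potential_lipschitz : lipschitz_fun mass potential.
Proof.
move=> y z; rewrite mulrC.
apply: (rcintegral_dist cT mu ler01 (kernel_lipschitz y) (kernel_lipschitz z)).
  exact: mdist_ge0.
by move=> x; exact: kernel_lip.
Qed.

Definition energy : R := rcintegral mu potential.

Lemma W_inner_energy : W_inner mu mu = energy%:E.
Proof.
rewrite /W_inner -(cintegral_lipschitz cT mu (variation_mass_ge0 mu) potential_lipschitz).
congr (cintegral mu _); apply/funext => y.
by rewrite (cintegral_lipschitz cT mu ler01 (kernel_lipschitz y)).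
Qed.

Lemma energy_partition e n x A : fine_partition (x0 := x0) e n x A ->
  `|energy - \sum_(i < n) \sum_(j < n)
      fine (mu (A i)) * fine (mu (A j)) * expR (- d (x i) (x j))| <= 2 * e * mass ^+ 2.
Proof.
move=> P; have m0 := variation_mass_ge0 mu.
have h1 := rcintegral_partition cT mu m0 potential_lipschitz P.
have h2 i := rcintegral_partition cT mu ler01 (kernel_lipschitz (x i)) P.
set S := \sum_(i < n) \sum_(j < n) _; set S1 := \sum_(i < n) _ in h1.
(* [h1] discretises the outer integral; here the potential at each centre is discretised in turn, at
   the same cost. *)
have h3 : `|S1 - S| <= e * mass * mass.
  rewrite -sumrB; apply: le_trans (ler_norm_sum _ _ _) _.
  apply: le_trans (_ : \sum_(i < n) e * mass * `|fine (mu (A i))| <= _).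
    apply: ler_sum => i _.
    have -> : \sum_(j < n) fine (mu (A i)) * fine (mu (A j)) * expR (- d (x i) (x j))
      = (\sum_(j < n) expR (- d (x j) (x i)) * fine (mu (A j))) * fine (mu (A i)).
      by rewrite mulr_suml; apply: eq_bigr => j _; rewrite metric_sym; ring.
    by rewrite -mulrBl normrM ler_wpM2r//; have := h2 i; rewrite mul1r.
  rewrite -mulr_sumr ler_wpM2l ?(sum_abs_partition mu P)//.
  (* The sign of [e] is not given, but [e * mass] bounds an absolute value. *)
  by have := h2 0%N; rewrite mul1r; apply: le_trans; exact: normr_ge0.
move: h1 h3; rewrite -/energy !ler_norml => /andP[? ?] /andP[? ?].
by rewrite !expr2; apply/andP; split; lra.
Qed.

End FixedCharge.

Lemma discrete_charge (s : seq (R * T)) : exists nu : {charge set X -> \bar R},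
  forall A, measurable A -> nu A = (\sum_(k <- s) k.1 * (k.2 \in A)%:R)%:E.
Proof.
elim: s => [|[c p] s [nu IH]].
  by exists czero => A mA; rewrite big_nil.
exists (cadd (cscale c (charge_of_finite_measure (dirac (p : X)))) nu) => A mA.
by rewrite /cadd big_cons EFinD -IH// EFinM.
Qed.

Lemma sum_indicator_partition (g : nat -> R) e n x (A : nat -> set X) (y : T) :
  fine_partition e n x A ->
  exists i, A i y /\ \sum_(j < n) g j * ((y : X) \in A j)%:R = g i.
Proof.
move=> P; have [i [ni Ai]] := fine_partition_ex y P; exists i; split => //.
rewrite (bigD1 (Ordinal ni))//= big1 ?addr0; first by rewrite mem_set// mulr1.
move=> j ji; rewrite memNset ?mulr0// => Aj.
have [_ tA _ _] := P; have := tA j i I I (ex_intro _ y (conj Aj Ai)).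
by move=> e'; move: ji; rewrite -val_eqE /= e' eqxx.
Qed.

(** Atoms may coincide and cancel, so the Jordan parts of [nu] are not explicit. Both sides are
    compared with a common Riemann sum instead, up to an arbitrary [e]. *)
Lemma rcintegral_discrete (nu : {charge set X -> \bar R}) (s : seq (R * T)) K f :
  (forall A, measurable A -> nu A = (\sum_(k <- s) k.1 * (k.2 \in A)%:R)%:E) ->
  0 <= K -> lipschitz_fun K f -> rcintegral nu f = \sum_(k <- s) k.1 * f k.2.
Proof.
move=> nuE K0 fK; apply/eqP; rewrite -subr_eq0 -normr_le0.
apply/ler_addgt0Pr => e e0; rewrite add0r.
set C := variation_mass nu + \sum_(k <- s) `|k.1|.
have C0 : 0 <= C by rewrite addr_ge0 ?variation_mass_ge0// sumr_ge0.
have e'0 : 0 < e / (K * C + 1) by rewrite divr_gt0// ltr_pwDr// mulr_ge0.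
have [n [x [A P]]] := exists_fine_partition x0 cT e'0.
have := rcintegral_partition cT nu K0 fK P; have [mA _ _ xA] := P.
set e' := e / _ in e'0 P xA *; set S := \sum_(i < n) _; set S' := \sum_(k <- s) _ => h1.
have eS : S = \sum_(k <- s) k.1 * \sum_(i < n) f (x i) * (k.2 \in A i)%:R.
  rewrite /S; under eq_bigr do rewrite nuE//= mulr_sumr.
  rewrite exchange_big /=; apply: eq_bigr => k _; rewrite mulr_sumr.
  by apply: eq_bigr => i _; rewrite mulrCA.
have h2 : `|S - S'| <= K * e' * \sum_(k <- s) `|k.1|.
  rewrite eS -sumrB mulr_sumr; apply: le_trans (ler_norm_sum _ _ _) _.
  apply: ler_sum => k _; rewrite -mulrBr normrM mulrC ler_wpM2r//.
  have [i [Ai ->]] := sum_indicator_partition (fun i => f (x i)) k.2 P.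
  by apply: le_trans (fK _ _) _; rewrite ler_wpM2l// xA.
have h3 : K * e' * C <= e.
  have : e' * (K * C + 1) = e by rewrite /e' divfK// gt_eqF// ltr_pwDr// mulr_ge0.
  nra.
rewrite /C mulrDr in h3.
rewrite -(subrK S (rcintegral nu f)) -addrA; apply: le_trans (ler_normD _ _) _; lra.
Qed.

Lemma energy_discrete (nu : {charge set X -> \bar R}) (s : seq (R * T)) :
  (forall A, measurable A -> nu A = (\sum_(k <- s) k.1 * (k.2 \in A)%:R)%:E) ->
  energy nu = \sum_(k <- s) \sum_(l <- s) k.1 * l.1 * expR (- d k.2 l.2).
Proof.
move=> nuE; rewrite /energy.
rewrite (rcintegral_discrete nuE (variation_mass_ge0 nu) (potential_lipschitz nu)).
apply: eq_bigr => k _; rewrite /potential.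
rewrite (rcintegral_discrete nuE ler01 (kernel_lipschitz k.2)) mulr_sumr.
by apply: eq_bigr => l _; rewrite metric_sym mulrA.
Qed.

End Energy.

(** * Finite meet-closed sets spanned by given points *)

Section FiniteSpan.
Context {R : realType} {T : metricType R} (HT : @is_Rtree R T) (r : T).
Local Notation below := (below r).
Local Notation meet := (meet HT r).

Definition rooted_subtree (F : seq T) : Prop :=
  [/\ uniq F, r \in F & {in F &, forall x y, meet x y \in F}].

Definition meet_span (G : seq T) : seq T :=
  undup [seq meet a b | a <- r :: G, b <- r :: G].

Lemma mem_meet_span G x :
  reflect (exists a b, [/\ a \in r :: G, b \in r :: G & x = meet a b]) (x \in meet_span G).
Proof.
rewrite mem_undup; apply: (iffP allpairsP) => [[[a b] /= [aG bG ->]]|[a [b [aG bG ->]]]].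
  by exists a, b.
by exists (a, b).
Qed.

Lemma sub_meet_span G : {subset r :: G <= meet_span G}.
Proof. by move=> a aG; apply/mem_meet_span; exists a, a; rewrite meetxx. Qed.

Lemma meet_span_below G x : x \in meet_span G -> exists2 a, a \in r :: G & below x a.
Proof. by move/mem_meet_span => [a [b [aG _ ->]]]; exists a => //; exact: meetl. Qed.

(** One round of pairwise meets suffices: applying [meet3] twice reduces a meet of four points to a
    meet of two of them. *)
Lemma meet_span_subtree G : rooted_subtree (meet_span G).
Proof.
split; [exact: undup_uniq|by apply: sub_meet_span; rewrite mem_head|].
move=> _ _ /mem_meet_span[a [b [aG bG ->]]] /mem_meet_span[a' [b' [aG' bG' ->]]].
apply/mem_meet_span; rewrite meetA.
by case: (meet3 HT r a b a') => ->; [case: (meet3 HT r a b b')|case: (meet3 HT r a a' b')] => ->;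
  [exists a, b|exists a, b'|exists a, a'|exists a, b'].
Qed.

End FiniteSpan.

(** * From finite subtrees to the whole tree *)

Section MagnitudeBounds.
Context {R : realType} {T : metricType R} (x0 : T) (cT : compact [set: T]).
Context (HT : @is_Rtree R T).
Local Notation d := (@mdist R T).
Local Notation X := (borel T x0).
Local Notation rooted_subtree := (rooted_subtree HT x0).

(** The test charge is [tree_weight] divided by its mass [M]; its energy is [M / M ^+ 2]. *)
Lemma magnitude_ge (F : seq T) : rooted_subtree F ->
  ((tree_magnitude x0 F)%:E <= @magnitude R T x0)%E.
Proof.
case=> uF rF mF; set M := tree_magnitude x0 F.
have M1 : 1 <= M := tree_magnitude_ge1 uF rF.
have M0 : 0 < M by exact: lt_le_trans M1.
pose s := [seq (k.1 / M, k.2) | k <- tree_weight x0 F].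
have [nu nuE] := discrete_charge x0 s.
apply: ereal_sup_ubound; exists nu => /=.
  rewrite nuE// big_map /=; congr _%:E.
  under eq_bigr do rewrite mem_set// mulr1.
  by rewrite -mulr_suml tree_weight_mass divff// gt_eqF.
rewrite (W_inner_energy cT) /= (energy_discrete cT nuE); congr _%:E.
rewrite big_map; under eq_bigr do rewrite big_map.
transitivity ((M / M ^+ 2)^-1); last by field; rewrite gt_eqF.
congr (_^-1); rewrite -[X in _ = X / _](tree_weight_energy uF rF mF) mulr_suml.
apply: eq_bigr => k _; rewrite mulr_suml; apply: eq_bigr => l _ /=.
by field; rewrite gt_eqF.
Qed.

(** Concentrating the charge of each cell at its centre keeps the mass equal to 1 and changes the
    energy by an arbitrarily small amount. [tree_cauchy_schwarz] then applies on the subtree spanned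
    by the centres. *)
Lemma energy_ge (mu : {charge set X -> \bar R}) (c : R) : mu [set: X] = 1%E ->
  (forall F, rooted_subtree F -> tree_length x0 F <= c) ->
  1 <= energy mu * (1 + c / 2).
Proof.
move=> mu1 Fc; apply/ler_addgt0Pr => e e0.
set V := variation_mass mu ^+ 2.
have V0 : 0 <= V by rewrite sqr_ge0.
have c0 : 0 <= 1 + c / 2.
  (* The subtree reduced to the root already forces [1 <= 1 + c / 2]. *)
  have FF := meet_span_subtree HT x0 [::]; have := Fc _ FF.
  case: FF => u r m; have := tree_magnitude_le u r.
  by have := tree_magnitude_ge1 u r; lra.
have VC : 0 <= 2 * V * (1 + c / 2) by apply: mulr_ge0 => //; apply: mulr_ge0.
have e'0 : 0 < e / (2 * V * (1 + c / 2) + 1).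
  by rewrite divr_gt0// ltr_pwDr.
have [n [x [A P]]] := exists_fine_partition x0 cT e'0.
have := energy_partition cT mu P; rewrite -/V.
set e' := e / _ in e'0 P *; set S := \sum_(i < n) _ => h1.
pose s := [seq (fine (mu (A i)), x i) | i <- iota 0 n].
have FF := meet_span_subtree HT x0 [seq k.2 | k <- s].
set F := meet_span _ _ _ in FF; case: (FF) => uF rF mF.
have sF : {in s, forall k, k.2 \in F}.
  by move=> k ks; apply: sub_meet_span; rewrite inE map_f ?orbT.
have := tree_cauchy_schwarz uF rF mF sF.
have -> : \sum_(k <- s) k.1 = 1.
  rewrite big_map /= -[X in iota 0 X](subn0 n) -/(index_iota 0 n) big_mkord.
  by rewrite (sum_charge_partition mu P) mu1.
have -> : \sum_(k <- s) \sum_(l <- s) k.1 * l.1 * expR (- d k.2 l.2) = S.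
  rewrite big_map; under eq_bigr do rewrite big_map /=.
  rewrite -[X in iota 0 X](subn0 n) -/(index_iota 0 n) big_mkord; apply: eq_bigr => i _.
  by rewrite big_mkord.
rewrite expr1n => h2.
have h3 : tree_magnitude x0 F <= 1 + c / 2.
  by have := tree_magnitude_le uF rF; have := Fc _ FF; lra.
have M1 := tree_magnitude_ge1 uF rF.
have h4 : e' * (2 * V * (1 + c / 2) + 1) = e.
  by rewrite /e' divfK// gt_eqF// ltr_pwDr.
have S0 : 0 <= S.
  rewrite -(pmulr_lge0 _ (lt_le_trans ltr01 M1)); apply: le_trans h2; exact: ler01.
have h5 : 1 <= S * (1 + c / 2) by apply: le_trans h2 _; rewrite ler_wpM2l.
move: h1; rewrite ler_norml => /andP[h1 _].
have : 0 <= (energy mu - S + 2 * e' * V) * (1 + c / 2) by rewrite mulr_ge0//; lra.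
nra.
Qed.

End MagnitudeBounds.

(** * Total length *)

Section LengthLowerBound.
Context {R : realType}.

(** Each [A j] lies in the closed interval of length [D j] starting at its infimum, so countable
    subadditivity of Lebesgue measure applies. *)
Lemma interval_cover (a b : R) (A : nat -> set R) (D : nat -> R) :
  `]a, b[%classic `<=` \bigcup_j A j -> (forall j s t, A j s -> A j t -> t - s <= D j) ->
  (forall j, 0 <= D j) -> ((b - a)%:E <= \sum_(0 <= j <oo) (D j)%:E)%E.
Proof.
move=> abA AD D0; pose I j : set R := `[inf (A j), inf (A j) + D j]%classic.
have AI j : A j `<=` I j.
  move=> x Ax; have lb y : A j y -> lbound (A j) (y - D j).
    by move=> Ay z Az; have := AD j z y Az Ay; lra.
  rewrite /I /= in_itv /=; apply/andP; split.
    by apply: ge_inf => //; exists (x - D j); exact: lb.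
  by rewrite -lerBlDr; apply: lb_le_inf; [exists x|exact: lb].
have mI j : measurable (I j) by exact: measurable_itv.
have sub : `]a, b[%classic `<=` \bigcup_j I j.
  by move=> x /abA[j _ /AI]; exists j.
have := @measure_sigma_subadditive _ _ _ (@lebesgue_measure R) `]a, b[%classic I
  mI (measurable_itv _) sub.
have -> : (\sum_(0 <= j <oo) lebesgue_measure (I j) = \sum_(0 <= j <oo) (D j)%:E)%E.
  apply: eq_eseriesr => j _; rewrite /I lebesgue_measure_itv /= lte_fin ltrDl.
  case: ltP => [_|D0']; first by rewrite -EFinB addrC addKr.
  by congr EFin; apply/eqP; rewrite eq_le D0 D0'.
apply: le_trans; apply: (@le_trans _ _ (lebesgue_measure `]a, b[%classic)) => //.
rewrite lebesgue_measure_itv /= lte_fin.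
by case: ltP => [_|ba]; rewrite ?EFinB// lee_fin subr_le0.
Qed.

Context {T : metricType R}.
Local Notation d := (@mdist R T).

Lemma diam_ge0 (A : set T) : (0 <= diam A)%E.
Proof. by apply: ereal_sup_ubound; right. Qed.

Lemma mdist_le_diam (A : set T) x y : A x -> A y -> ((d x y)%:E <= diam A)%E.
Proof. by move=> Ax Ay; apply: ereal_sup_ubound; left; exists x => //; exists y. Qed.

Context (HT : @is_Rtree R T) (r : T).
Local Notation h := (height r).
Local Notation below := (below r).
Local Notation meet := (meet HT r).

Lemma below_skeleton x p : below x p -> x <> r -> x <> p -> skeleton x.
Proof.
move=> xp xr npx; have [S hS] := segment_exists HT r p.
by exists r, p, S; split => //; apply: (between_segment HT hS); exact/below_between.
Qed.

Section Pieces.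
Context (F : seq T) (SF : rooted_subtree HT r F) (e : R) (e0 : 0 < e).

(* The edge ending at [p], shrunk by [e] at both ends: a set of diameter at most [e]
   meets at most one piece. *)
Definition piece (p : T) : set T :=
  [set x | [/\ below x p, e < h x - h (parent r F p) & e < h p - h x]].

Lemma piece_skeleton p x : piece p x -> skeleton x.
Proof.
case=> xp l1 l2; have p0 := height_ge0 r (parent r F p); have e0' := e0.
apply: (below_skeleton xp) => xe; subst x.
  by move: l1; rewrite height_root ltNge => /negP; apply; lra.
by move: l2; rewrite ltNge => /negP; apply; lra.
Qed.

(** If [p] is below [q], then [y] is more than [e] above [p] and [x] more than [e] under it.
    Otherwise [meet x y] is below [parent p], and the path from [x] to [y] descends by more than [e]
    to reach it. *)
Lemma piece_separated p q x y : p \in F -> q \in F -> p != q ->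
  piece p x -> piece q y -> e < d x y.
Proof.
case: SF => uF rF mF pF qF npq [xp x1 x2] [yq y1 y2]; have e0' := e0.
have hxy := height_lip r x y; rewrite ler_norml in hxy; case/andP: hxy => hxy1 hxy2.
case: (boolP (below p q)) => [pq|npq'].
  have := below_height (parent_max HT pF pq npq); lra.
have mp : below (meet p q) (parent r F p).
  apply: (parent_max HT) => //; rewrite ?mF ?meetl//.
  by apply: contra npq' => /eqP <-; exact: meetr.
have mm : below (meet x y) (meet p q).
  rewrite below_meet (below_trans (meetl _ _ _ _) xp).
  exact: below_trans (meetr _ _ _ _) yq.
have := below_height mm; have := below_height mp.
have := below_height (meetr HT r x y); rewrite (mdist_meet HT r x y); lra.
Qed.

Lemma piece_point p (t : R) : e < t - h (parent r F p) -> e < h p - t ->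
  exists x, piece p x /\ h x = t.
Proof.
move=> t1 t2; have p0 := height_ge0 r (parent r F p); have e0' := e0.
have [|x [xp hx]] := @below_point _ _ HT r p t; first by apply/andP; split; lra.
by exists x; split => //; split; rewrite ?hx.
Qed.

(** Heights are 1-Lipschitz, so the sets [U j] meeting a piece have diameters adding up to at least
    its height range. By separation no [U j] meets two pieces, so each diameter is counted at most
    once. *)
Lemma tree_length_delta :
  ((tree_length r F - \sum_(p <- F | p != r) 2 * e)%:E
    <= hausdorff1_delta e (@skeleton R T))%E.
Proof.
case: (SF) => uF rF mF; apply: le_ereal_inf_tmp => _ [U [covU diamU ->]].
have finD j : diam (U j) = (fine (diam (U j)))%:E.
  rewrite fineK// ge0_fin_numE ?diam_ge0//; apply: le_lt_trans (diamU j) _.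
  exact: ltry.
pose hit p j := `[< U j `&` piece p !=set0 >].
pose D p j := if hit p j then fine (diam (U j)) else 0.
have D0 p j : 0 <= D p j by rewrite /D; case: ifP => // _; rewrite fine_ge0// diam_ge0.
have pieceD p : ((h p - h (parent r F p) - 2 * e)%:E <= \sum_(0 <= j <oo) (D p j)%:E)%E.
  have -> : h p - h (parent r F p) - 2 * e = (h p - e) - (h (parent r F p) + e) by ring.
  apply: (@interval_cover _ _ (fun j => h @` (U j `&` piece p))) => [t| |].
  - rewrite /= in_itv /= => /andP[t1 t2].
    have [||x [px <-]] := @piece_point p t; [lra|lra|].
    by have [j _ Ujx] := covU x (piece_skeleton px); exists j => //; exists x.
  - move=> j _ _ [x [Ux px] <-] [y [Uy py] <-].
    have -> : D p j = fine (diam (U j)) by rewrite /D ifT//; apply/asboolP; exists x.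
    rewrite -lee_fin -finD; apply: le_trans (mdist_le_diam Ux Uy).
    rewrite lee_fin; have := height_lip r x y; rewrite ler_norml => /andP[+ _]; lra.
  - exact: D0.
have oneD j : (\sum_(p <- F | p != r) (D p j)%:E <= diam (U j))%E.
  case: (pselect (exists2 p, p \in F & hit p j)) => [[p pF hp]|nh]; last first.
    rewrite big_seq_cond big1 ?diam_ge0// => p /andP[pF _]; rewrite /D ifF//.
    by apply/negP => hp; apply: nh; exists p.
  rewrite big_mkcond (bigD1_seq p)//= big1_seq ?adde0.
    by case: ifP => _; rewrite ?diam_ge0// /D hp -finD.
  move=> q /andP[qp qF]; case: ifP => // _; rewrite /D ifF//.
  apply/negP => /asboolP[y [Uy qy]].
  case/asboolP: hp => x [Ux px].
  have := piece_separated pF qF _ px qy; rewrite eq_sym => /(_ qp).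
  by rewrite ltNge -lee_fin => /negP; apply; apply: le_trans (mdist_le_diam Ux Uy) (diamU j).
rewrite /tree_length -sumrB -sumEFin.
apply: (@le_trans _ _ (\sum_(p <- F | p != r) \sum_(0 <= j <oo) (D p j)%:E)%E).
  by apply: lee_sum => p _; exact: pieceD.
rewrite -nneseries_sum; last by move=> *; rewrite lee_fin.
by apply: lee_nneseries => // j _; rewrite sume_ge0// => p _; rewrite lee_fin.
Qed.

End Pieces.

Lemma tree_length_le (F : seq T) : rooted_subtree HT r F ->
  ((tree_length r F)%:E <= @total_length R T)%E.
Proof.
move=> SF; apply/lee_addgt0Pr => e e0.
(* Shrinking by [e / (k + 1)] loses [k * (e / (k + 1))] in total, which is at most [e]. *)
set k := \sum_(p <- F | p != r) (2 : R).
have k0 : 0 <= k by rewrite sumr_ge0.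
have e'0 : 0 < e / (k + 1) by rewrite divr_gt0// ltr_pwDr.
have h1 := tree_length_delta SF e'0.
rewrite -mulr_suml -/k in h1.
have h2 : (hausdorff1_delta (e / (k + 1)) (@skeleton R T) <= total_length (T := T))%E.
  by apply: ereal_sup_ubound; exists (e / (k + 1)).
have := le_trans h1 h2; rewrite EFinB leeBlDr//; move=> h3; apply: le_trans h3 _.
rewrite leeD2l// lee_fin mulrA ler_pdivrMr ?ltr_pwDr//; nra.
Qed.

End LengthLowerBound.

(** * Covering the skeleton by branches *)

Section LengthUpperBound.
Context {R : realType}.

(** Covers in [hausdorff1_delta] are indexed by [nat], while the branches and their pieces give a
    doubly indexed family. *)
Lemma nneseries_prod (a : nat -> nat -> \bar R) : (forall i j, 0 <= a i j)%E ->
  exists f : nat -> nat * nat,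
    (forall i j, exists k, f k = (i, j)) /\
    (\sum_(0 <= k <oo) a (f k).1 (f k).2 = \sum_(0 <= i <oo) \sum_(0 <= j <oo) a i j)%E.
Proof.
move=> a0; have /card_esym/ppcard_eqP[f] := card_nat2.
exists f; split.
  by move=> i j; exists (f^-1%FUN (i, j)); rewrite invK ?inE.
rewrite nneseries_esumT//.
rewrite -(@reindex_esum _ _ _ setT setT f (fun k => a k.1 k.2)); last exact: bij.
transitivity (\esum_(i in [set: nat]) \esum_(j in [set: nat]) a i j)%E.
  rewrite esum_esum//; congr esum; apply/seteqP; split => -[i j] //=.
by rewrite -nneseries_esumT; [apply: eq_eseriesr => i _; rewrite nneseries_esumT|
  move=> i; exact: esum_ge0].
Qed.

Lemma grid_point (w u : R) (N : nat) : (0 < N)%N -> 0 <= u -> u <= N%:R * w ->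
  exists2 k, (k < N)%N & k%:R * w <= u <= k.+1%:R * w.
Proof.
move=> N0 u0; elim: N N0 => // -[_ _|N IH _]; first by exists 0%N => //; rewrite mul0r u0.
case: (leP u (N.+1%:R * w)) => [/(IH isT)[k kN ku] _|/ltW lu uN].
  by exists k => //; exact: ltnW.
by exists N.+1 => //; rewrite lu.
Qed.

Context {T : metricType R} (x0 : T) (cT : compact [set: T]) (HT : @is_Rtree R T).
Local Notation d := (@mdist R T).
Local Notation h := (height x0).
Local Notation below := (below x0).
Local Notation meet := (meet HT x0).

Lemma exists_dense_sequence : exists z : nat -> T,
  forall x e, 0 < e -> exists n, d x (z n) < e.
Proof.
have P k : exists X : nat -> T, forall x, exists i, d (X i) x <= (k.+1%:R)^-1 :> R.
  have k0 : 0 < (k.+1%:R)^-1 :> R by rewrite invr_gt0.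
  have [n [X [A PA]]] := exists_fine_partition x0 cT k0.
  exists X => x; have [i [_ Ai]] := fine_partition_ex x PA; exists i.
  by case: PA => _ _ _; apply.
have [X XP] := choice P.
exists (fun m => if unpickle m is Some ki then X ki.1 ki.2 else x0) => x e e0.
have [k ke] : exists k : nat, (k.+1%:R)^-1 < e.
  by have [k] := ltr_add_invr e0; rewrite add0r => ke; exists k.
have [i Xi] := XP k x; exists (pickle (k, i)); rewrite pickleK /= metric_sym.
exact: le_lt_trans ke.
Qed.

(** One end [u] of the segment is a strict descendant of [p]. A [z n] closer to [u] than [p] is
    cannot be separated from [u] by [p], so [p] lies between [z n] and the root. *)
Lemma skeleton_below (z : nat -> T) (p : T) :
  (forall x e, 0 < e -> exists n, d x (z n) < e) -> skeleton p ->
  exists n, below p (z n).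
Proof.
move=> zd [x [y [S [hS Sp px py]]]].
have xpy := segment_between hS Sp.
suff [u [pu npu]] : exists u, below p u /\ p != u.
  have pu0 : 0 < d u p by rewrite mdist_gt0 eq_sym.
  have [n un] := zd u _ pu0; exists n.
  have /between_sym := (below_between x0 _ _).1 pu => upr.
  case: (between_split HT (z n) upr) => [|/between_sym/below_between//].
  by rewrite /between => e; move: un; rewrite ltNge -e lerDl mdist_ge0.
case: (between_split HT x0 xpy) => [/between_sym|] /below_between pu; [exists x|exists y];
  by split => //; apply/eqP.
Qed.

Section Branches.
Context (z : nat -> T).

(* The height at which the segment from the root to [z n] leaves the subtree spanned by
   the root and the earlier points. *)
Definition branch_height (n : nat) : R :=
  \big[Order.max/0]_(j < n) h (meet (z n) (z j)).
Local Notation q := branch_height.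

Definition branch_length (n : nat) : R := h (z n) - q n.

Lemma branch_point n : exists2 b, below b (z n) /\ h b = q n &
  b = x0 \/ exists2 j, (j < n)%N & b = meet (z n) (z j).
Proof.
rewrite /q; elim/big_ind : _ => [||j _].
- exists x0; last by left.
  by split; [exact: root_below|exact: height_root].
- move=> u v [b [bz hb] b1] [c [cz hc] c1].
  by rewrite /Order.max; case: ifP => _; [exists c|exists b].
- exists (meet (z n) (z j)); first by split => //; exact: meetl.
  by right; exists j; rewrite ?ltn_ord.
Qed.

Lemma branch_height_ge n j : (j < n)%N -> h (meet (z n) (z j)) <= q n.
Proof. by move=> jn; rewrite /q (bigD1 (Ordinal jn))//= le_max lexx. Qed.

Lemma branch_length_ge0 n : 0 <= branch_length n.
Proof.
by have [b [bz hb] _] := branch_point n; rewrite subr_ge0 -hb below_height.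
Qed.

(** Take the first [m] with [p] below [z m]. Were the branch point higher than [p], then [p] would
    be below an earlier [z j]. *)
Lemma branch_cover p n : below p (z n) -> exists m, below p (z m) /\ q m <= h p.
Proof.
move=> pn; have ex : exists n, below p (z n) by exists n.
case: (ex_minnP ex) => m pm mmin; exists m; split => //.
have [b [bz <-] [->|[j jm be]]] := branch_point m.
  by rewrite height_root height_ge0.
case: (leP (h b) (h p)) => // /ltW pb.
have := below_chain HT pm bz pb; rewrite be below_meet => /andP[_ /mmin].
by rewrite leqNgt jm.
Qed.

(** Each branch is cut by height into pieces of equal width at most [e]; along a branch, distances
    are differences of height. *)
Lemma hausdorff1_delta_branches (e : R) : 0 < e ->
  (forall x e, 0 < e -> exists n, d x (z n) < e) ->
  (hausdorff1_delta e (@skeleton R T) <= \sum_(0 <= n <oo) (branch_length n)%:E)%E.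
Proof.
move=> e0 zd; pose N n := (Num.bound (branch_length n / e)).+1.
pose w n := branch_length n / (N n)%:R.
have w0 n : 0 <= w n by rewrite divr_ge0 ?branch_length_ge0.
have we n : w n <= e.
  rewrite /w ler_pdivrMr// mulrC -ler_pdivrMr//.
  have := archi_boundP (divr_ge0 (branch_length_ge0 n) (ltW e0)).
  by move=> /ltW /le_trans; apply; rewrite ler_nat /N.
pose U n k := if (k < N n)%N then
  [set x | below x (z n) /\ k%:R * w n <= h x - q n <= k.+1%:R * w n] else set0.
have dU n k : (diam (U n k) <= (if (k < N n)%N then w n else 0)%:E)%E.
  apply: ge_ereal_sup => _ [[x Ux [y Uy] <-]|->]; last by rewrite lee_fin; case: ifP.
  move: Ux Uy; rewrite /U; case: ifP => // _ [xz /andP[x1 x2]] [yz /andP[y1 y2]].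
  rewrite lee_fin; rewrite -natr1 in x2 y2.
  have [xy|yx] := orP (below_total HT xz yz); first by rewrite (belowP _ _ _ xy); lra.
  by rewrite metric_sym (belowP _ _ _ yx); lra.
have U0 n k : (0 <= diam (U n k))%E by exact: diam_ge0.
have [f [fsurj fsum]] := nneseries_prod U0.
apply: (@le_trans _ _ (\sum_(0 <= k <oo) diam (U (f k).1 (f k).2))%E).
  apply: ereal_inf_lbound; exists (fun k => U (f k).1 (f k).2); split => //.
  - move=> p /(skeleton_below zd)[n /branch_cover[m [pm qm]]].
    have [k kN pk] : exists2 k : nat, (k < N m)%N & k%:R * w m <= h p - q m <= k.+1%:R * w m.
      apply: grid_point => //; first by rewrite subr_ge0.
      by rewrite /w mulrC divfK ?pnatr_eq0// lerD2r below_height.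
    by have [i fi] := fsurj m k; exists i => //; rewrite fi /U /= kN.
  - move=> i; apply: le_trans (dU _ _) _; rewrite lee_fin; case: ifP => _ //.
    exact: ltW.
rewrite fsum; apply: lee_nneseries => [n _ _|n _]; first exact: nneseries_ge0.
apply: lime_le; first by apply: is_cvg_nneseries.
(* Only the first [N n] pieces are nonempty, so the partial sums stop growing at [N n] times the
   width, the branch length. *)
apply: nearW => m; apply: (@le_trans _ _ ((minn m (N n))%:R * w n)%:E).
  elim: m => [|m IH]; first by rewrite big_geq// min0n mul0r.
  rewrite big_nat_recr//=; apply: le_trans (leeD IH (dU n m)) _.
  rewrite -EFinD lee_fin; case: ifPn => [mN|]; last rewrite -leqNgt => Nm.
    by rewrite (minn_idPl (ltnW mN)) (minn_idPl mN) -natr1 mulrDl mul1r.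
  by rewrite (minn_idPr Nm) (minn_idPr (leqW Nm)) addr0.
rewrite lee_fin; have -> : branch_length n = (N n)%:R * w n by rewrite /w mulrC divfK ?pnatr_eq0.
by rewrite ler_wpM2r// ler_nat geq_minr.
Qed.

End Branches.
End LengthUpperBound.

(** * Finite subtrees with short edges *)

Section FineSubtrees.
Context {R : realType} {T : metricType R} (x0 : T).
Context (HT : @is_Rtree R T) (z : nat -> T).
Local Notation h := (height x0).
Local Notation below := (below x0).
Local Notation meet := (meet HT x0).
Local Notation q := (branch_height x0 HT z).

(** The generators are the [z i] and the points at heights multiple of [e] on the segments from the
    root to them. Every point of the span lies on such a segment and so has a grid point just under
    it. *)
Lemma fine_subtree (n : nat) (e : R) : 0 < e -> exists F,
  [/\ rooted_subtree HT x0 F,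
      {in F, forall p, p != x0 -> h p - h (parent x0 F p) <= e},
      forall i, (i < n)%N -> z i \in F &
      forall i j, (i < n)%N -> (j < n)%N -> meet (z i) (z j) \in F].
Proof.
move=> e0; pose pt c (t : R) := xget x0 [set p | below p c /\ h p = t].
have ptP c t : 0 <= t <= h c -> below (pt c t) c /\ h (pt c t) = t.
  move=> /(below_point HT)[p pc].
  exact: (@xgetPex _ x0 [set p | below p c /\ h p = t] (ex_intro _ p pc)).
pose K := Num.bound ((\sum_(i < n) h (z i)) / e).
have KP i : (i < n)%N -> h (z i) < K%:R * e.
  move=> ni; rewrite -ltr_pdivrMr//; apply: le_lt_trans (archi_boundP _); last first.
    by rewrite divr_ge0 ?(ltW e0)// sumr_ge0// => j _; exact: height_ge0.
  rewrite ler_pM2r ?invr_gt0// (bigD1 (Ordinal ni))//= lerDl.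
  by rewrite sumr_ge0// => j _; exact: height_ge0.
pose grid := [seq pt (z i) (k%:R * e) |
  i <- iota 0 n, k <- [seq k <- iota 0 K | k%:R * e <= h (z i)]].
pose G := [seq z i | i <- iota 0 n] ++ grid.
have zG i : (i < n)%N -> z i \in x0 :: G.
  by move=> ni; rewrite inE mem_cat map_f ?orbT// mem_iota.
exists (meet_span HT x0 G); set F := meet_span HT x0 G.
have SF : rooted_subtree HT x0 F by exact: meet_span_subtree.
have subF := @sub_meet_span _ _ HT x0 G.
split => //; last 2 first.
- by move=> i ni; apply: subF; exact: zG.
- by move=> i j ni nj; apply/mem_meet_span; exists (z i), (z j); rewrite !zG.
move=> p /meet_span_below[a aG pa] px.
have [i ni pz] : exists2 i, (i < n)%N & below p (z i).
  move: aG; rewrite inE mem_cat => /orP[/eqP ax|/orP[/mapP[i]|]].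
  - rewrite ax in pa; case/eqP: px; exact: below_anti pa (root_below _ _).
  - by rewrite mem_iota => /andP[_ ni] az; exists i; rewrite -?az.
  - move=> /allpairsPdep[i [k [+ + az]]]; rewrite mem_iota mem_filter => /andP[_ ni] /andP[kz _].
    exists i => //; apply: below_trans pa _; rewrite az.
    by have [] := ptP (z i) (k%:R * e); rewrite // kz mulr_ge0// ltW.
have pz0 := below_height pz.
have hp0 : 0 < h p by rewrite mdist_gt0 eq_sym.
(* The lower inequality is strict so that the grid point at height [k%:R * e] differs from [p]. *)
have [k kK /andP[k1 k2]] : exists2 k, (k < K)%N & k%:R * e < h p <= k.+1%:R * e.
  have ex : exists k, h p <= k%:R * e by exists K; exact: le_trans pz0 (ltW (KP _ ni)).
  case: (ex_minnP ex) => -[|m] mp mmin; first by move: mp; rewrite mul0r leNgt hp0.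
  have mlt : m%:R * e < h p by rewrite ltNge; apply/negP => /mmin; rewrite ltnn.
  exists m; last by rewrite mlt.
  by have := lt_trans (lt_le_trans mlt pz0) (KP _ ni); rewrite ltr_pM2r// ltr_nat.
have hz : 0 <= k%:R * e <= h (z i).
  by rewrite mulr_ge0 ?(ltW e0)//=; apply: ltW; exact: lt_le_trans pz0.
have [sz hs] := ptP _ _ hz; set s := pt _ _ in sz hs.
have sF : s \in F.
  apply: subF; rewrite inE mem_cat; apply/orP; right; apply/orP; right.
  apply/allpairsPdep; exists i, k; split => //; first by rewrite mem_iota.
  by rewrite mem_filter mem_iota kK; case/andP: hz => _ ->.
have sp : below s p by apply: (below_chain HT sz pz); rewrite hs ltW.
have nsp : s != p by apply: contraTneq k1 => <-; rewrite hs ltxx.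
have := below_height (parent_max HT sF sp nsp); rewrite hs.
move: k2; rewrite -natr1 mulrDl mul1r; lra.
Qed.

Lemma tree_lengthE (F : seq T) : tree_length x0 F = \sum_(p <- F) increment x0 F h p.
Proof.
rewrite /tree_length big_mkcond; apply: eq_bigr => p _; rewrite /increment.
by case: eqP => [->|//]; rewrite height_root subr0.
Qed.

(** Induction on the number of branches. The points of [F] below [z m] and below an earlier [z i]
    are below the branch point [b], so the newly reached points carry height increments of at least
    [h (z m) - h b]. *)
Lemma branch_length_le (F : seq T) n : rooted_subtree HT x0 F ->
  (forall i, (i < n)%N -> z i \in F) ->
  (forall i j, (i < n)%N -> (j < n)%N -> meet (z i) (z j) \in F) ->
  \sum_(i < n) branch_length x0 HT z i <= tree_length x0 F.
Proof.
move=> [uF rF mF] zF zzF; rewrite tree_lengthE.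
have inc0 p : 0 <= increment x0 F h p.
  rewrite /increment; case: ifP => _; first by rewrite subr0 height_ge0.
  by rewrite subr_ge0 parent_height.
pose hit m p := has (fun i => below p (z i)) (iota 0 m).
suff H m : (m <= n)%N -> \sum_(i < m) branch_length x0 HT z i <=
    \sum_(p <- F | hit m p) increment x0 F h p.
  apply: le_trans (H n (leqnn n)) _; rewrite big_mkcond; apply: ler_sum => p _.
  by case: ifP.
elim: m => [|m IH mn]; first by rewrite big_ord0 sumr_ge0.
rewrite big_ord_recr /= (bigID (hit m))/=; apply: lerD.
  apply: le_trans (IH (ltnW mn)) _; rewrite le_eqVlt; apply/orP; left; apply/eqP.
  apply: eq_bigl => p; rewrite /hit -addn1 iotaD has_cat /=.
  by case: (has _ (iota 0 m)); rewrite ?andbF ?orbT.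
have [b [bz hb] bF] := branch_point x0 HT z m.
have {}bF : b \in F.
  by case: bF => [->//|[j jm ->]]; apply: zzF => //; exact: ltn_trans jm mn.
rewrite /branch_length -hb lerBlDl -(telescope HT uF rF h (zF m mn)) (bigID (hit m))/=.
apply: lerD.
  rewrite -(telescope HT uF rF h bF) big_mkcond [leRHS]big_mkcond.
  apply: ler_sum => p _; case: ifPn => [/andP[pz /hasP[i]]|_]; last by case: ifP.
  rewrite mem_iota => /andP[_ im] pi; rewrite ifT// (below_chain HT pz bz)// hb.
  by apply: le_trans (branch_height_ge _ _ _ im); rewrite below_height// below_meet pz.
rewrite big_mkcond [leRHS]big_mkcond; apply: ler_sum => p _.
case: ifPn => [/andP[pz nh]|_]; last by case: ifP.
by rewrite ifT// nh andbT /hit -addn1 iotaD has_cat /= pz !orbT.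
Qed.

End FineSubtrees.

(** * Comparison of magnitude and total length *)

Section MagnitudeOfTree.
Context {R : realType} {T : metricType R} (x0 : T).
Context (cT : compact [set: T]) (HT : @is_Rtree R T).

(** A finite total length [c] bounds every [tree_length], so [energy_ge] bounds the energy of each
    unit charge from below; the infinite case is immediate. *)
Lemma magnitude_le_length :
  (@magnitude R T x0 <= 1 + @total_length R T * (2^-1)%:E)%E.
Proof.
have : (0 <= @total_length R T)%E.
  have := tree_length_le (meet_span_subtree HT x0 [::]).
  apply: le_trans; rewrite lee_fin /tree_length sumr_ge0// => p _.
  by rewrite subr_ge0 parent_height.
case El : total_length => [c| |]// c0; last first.
  by rewrite gt0_mulye ?lte_fin ?invr_gt0// addey// leey.
rewrite lee_fin in c0; apply: ge_ereal_sup => _ [mu mu1 <-].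
rewrite (W_inner_energy cT) -EFinM -EFinD lee_fin /=.
have h1 : 1 <= energy mu * (1 + c / 2).
  apply: (energy_ge cT mu1) => F SF; rewrite -lee_fin -El.
  exact: tree_length_le.
have E0 : 0 < energy mu.
  by rewrite -(pmulr_lgt0 _ (_ : 0 < 1 + c / 2)) ?(lt_le_trans ltr01 h1)//; lra.
by rewrite -[leLHS]mulr1 mulrC ler_pdivrMr// mulrC.
Qed.

(** When the magnitude is finite, it bounds every [tree_magnitude], hence the length of finite
    subtrees with short edges, hence the partial sums of branch lengths. *)
Lemma length_le_magnitude :
  (1 + @total_length R T * (2^-1)%:E <= @magnitude R T x0)%E.
Proof.
have mag1 : (1 <= @magnitude R T x0)%E.
  have SF := meet_span_subtree HT x0 [::]; apply: le_trans (magnitude_ge cT SF).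
  by case: SF => uF rF _; rewrite lee_fin tree_magnitude_ge1.
have [z zd] := exists_dense_sequence x0 cT.
case Em : (@magnitude R T x0) mag1 => [m| |]// m1; last by rewrite leey.
rewrite lee_fin in m1.
suff le_len : (@total_length R T <= (2 * (m - 1))%:E)%E.
  have -> : m%:E = (1 + (2 * (m - 1))%:E * (2^-1)%:E)%E.
    by rewrite -EFinM -EFinD; congr EFin; field.
  by rewrite leeD2l// lee_pmul2r ?lte_fin ?invr_gt0.
apply: ge_ereal_sup => _ [e /= e0 <-].
apply: le_trans (hausdorff1_delta_branches x0 HT e0 zd) _.
apply: lime_le.
  by apply: is_cvg_nneseries => n _ _; rewrite lee_fin branch_length_ge0.
apply: nearW => n; rewrite big_mkord sumEFin lee_fin.
set S := \sum_(i < n) _; have S0 : 0 <= S.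
  by rewrite sumr_ge0// => i _; exact: branch_length_ge0.
apply/ler_addgt0Pr => t t0.
(* The bound by 1 keeps [1 - u / 2] positive, and the other one makes the loss [S * u / 2] smaller
   than [t]. *)
pose u := Num.min 1 (t / (S + 1)).
have u0 : 0 < u by rewrite lt_min ltr01 divr_gt0// ltr_pwDr.
have u1 : u <= 1 by rewrite ge_min lexx.
have uS : u * (S + 1) <= t by rewrite -ler_pdivlMr ?ltr_pwDr// ge_min lexx orbT.
have [F [SF mesh zF zzF]] := fine_subtree x0 HT z n u0.
have SL := branch_length_le SF zF zzF; rewrite -/S in SL.
case: (SF) => uF rF mF; have := tree_magnitude_ge uF rF mesh.
have := magnitude_ge cT SF; rewrite Em lee_fin.
set L := tree_length _ _ in SL *; set M := tree_magnitude _ _.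
have : S * (1 - u / 2) <= L * (1 - u / 2) by rewrite ler_wpM2r//; lra.
nra.
Qed.

End MagnitudeOfTree.

Local Open Scope ereal_scope.

Theorem theorem3p5 (R : realType) (T : metricType R) (x0 : T) :
  compact [set: T] -> @is_Rtree R T ->
  @magnitude R T x0 = 1 + @total_length R T * (2^-1)%:E.
Proof.
move=> cT HT; apply/eqP.
by rewrite eq_le magnitude_le_length ?length_le_magnitude.
Qed.
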